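(* Let $\varphi$ be an endomorphism of a subshift $(X,\sigma)$. Then $Q_R(\varphi)+Q_L(\varphi)\ge0$ if and only if there exists $s\in\mathbb Z$ such that $(\varphi\sigma^s)^{[t]}$ is weakly $q$-biresolving for some $t\ge1$. For $s\in\mathbb Z$, $(\varphi\sigma^s)^{[t]}$ is weakly $q$-biresolving for some $t\ge1$ if and only if $-Q_R(\varphi)\le s\le Q_L(\varphi)$. If $-Q_R(\varphi)<s<Q_L(\varphi)$, then $\varphi\sigma^s$ is positively expansive.
   Context: **Subshifts.** An alphabet is a finite set with at least two elements. For an alphabet $A$, $A^{\mathbb Z}$ carries the product topology; the shift maps $(a_j)_j$ to $(a_{j+1})_j$. A subshift $(X,\sigma)$ over $A$ is a closed $X\subset A^{\mathbb Z}$ with $\sigma(X)=X$, $\sigma$ being the restricted shift; $d_X$ is a compatible metric; $L_k(X)$ is the set of words of length $k$ occurring in points of $X$. An endomorphism of $(X,\sigma)$ is a continuous map $\varphi:X\to X$ commuting with $\sigma$ (not assumed onto). It is positively expansive if there is $\delta>0$ such that $d_X(\varphi^i(x),\varphi^i(y))\le\delta$ for all $i\ge0$ implies $x=y$. **Higher blocks.** For $t\ge1$, $X^{[t]}=\{(a_j\dots a_{j+t-1})_{j\in\mathbb Z}: (a_j)\in X\}$, a subshift over the alphabet $L_t(X)$ with shift $\sigma^{[t]}$; if $\varphi((a_j))=(b_j)$ then $\varphi^{[t]}$ maps $(a_j\dots a_{j+t-1})_j$ to $(b_j\dots b_{j+t-1})_j$, an endomorphism of $(X^{[t]},\sigma^{[t]})$.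 **Type.** A local rule of neighborhood-size $N\ge 0$ on $X$ is a map $f:L_{N+1}(X)\to L_1(X)$ with $(f(a_j\dots a_{j+N}))_{j\in\mathbb Z}\in X$ for all $(a_j)\in X$. For $m,n\ge0$, $m+n=N$, $\varphi$ is of $(m,n)$-type given by $f$ if $\varphi((a_j)_j)=(f(a_{j-m}\dots a_{j+n}))_j$. Every endomorphism arises this way. **$q$-degrees.** A local rule $f$ of neighborhood-size $N$ is $k$ right-mergible ($k\ge0$) if for all $(a_j),(b_j)\in X$, $a_j=b_j$ for $j\le 0$ and $f(a_{j-N}\dots a_j)=f(b_{j-N}\dots b_j)$ for $1\le j\le k+1$ imply $a_1=b_1$; $k$ left-mergible if $a_j=b_j$ for $j\ge0$ and $f(a_{-j}\dots a_{-j+N})=f(b_{-j}\dots b_{-j+N})$ for $1\le j\le k+1$ imply $a_{-1}=b_{-1}$. It is strictly $k$ right-mergible if $k\ge 0$ is the least integer for which it is $k$ right-mergible, strictly $\infty$ right-mergible if there is none; similarly for left. If $X$ is infinite and $\varphi$ is of $(m,n)$-type given by $f$ which is strictly $k$ right-mergible and strictly $l$ left-mergible, then $Q_R(\varphi)=n-k$, $Q_L(\varphi)=m-l$ (in $\mathbb Z\cup\{-\infty\}$); if $X$ is finite, $Q_R(\varphi)=Q_L(\varphi)=\infty$. These are independent of the choice of $f,m,n$. **Graphs and textile systems.** A graph is a finite directed graph $G$ (multiple arcs, loops allowed) with arc-set $A_G$, vertex-set $V_G$ and initial/terminal vertex maps $i_G,t_G$; $X_G\subset A_G^{\mathbb Z}$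 is the set of bi-infinite paths. A graph-homomorphism $h=(h_A,h_V):\Gamma\to G$ is a pair of maps on arcs and vertices compatible with $i,t$; it induces $\phi_h:X_\Gamma\to X_G$, $(\alpha_j)\mapsto(h_A(\alpha_j))$. $h$ is weakly left-resolving (resp. weakly right-resolving) if every arc $\alpha$ of $\Gamma$ is uniquely determined by $t_\Gamma(\alpha)$ (resp. $i_\Gamma(\alpha)$) and $h_A(\alpha)$. A textile system $T=(p,q:\Gamma\to G)$ is a pair of graph-homomorphisms $p,q:\Gamma\to G$; it is weakly $q$-biresolving if $q$ is both weakly left-resolving and weakly right-resolving. An endomorphism $\varphi$ of a subshift $(X,\sigma)$ is weakly $q$-biresolving if there are a weakly $q$-biresolving textile system $T=(p,q:\Gamma\to G)$ and a closed shift-invariant $Z\subset X_\Gamma$ such that $\phi_p|_Z$ is injective, $\phi_p(Z)=X$, $\phi_q(Z)\subset X$ and $\varphi=\phi_q\circ(\phi_p|_Z)^{-1}$. *)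

(* Defs.v *)
From mathcomp Require Import all_boot all_order all_algebra.
From mathcomp Require Import all_classical all_reals all_analysis.

Set Implicit Arguments.
Unset Strict Implicit.
Unset Printing Implicit Defensive.

Import Order.TTheory GRing.Theory Num.Theory.
Local Open Scope classical_set_scope.
Local Open Scope ring_scope.

(* The full shift space: A carries the discrete topology, A^Z the product
   topology. *)
Notation config A := {ptws int -> discrete_topology A}.

(* The s-th power of the shift map, for s of any sign; sigma is shiftZ 1. *)
Definition shiftZ (A : finType) (s : int) (x : config A) : config A :=
  fun j => x (j + s).

Definition subshift (A : finType) (X : set (config A)) : Prop :=
  closed X /\ shiftZ 1 @` X = X.

(* Endomorphisms of X are represented by maps on the full shift space, of which
   only the values on X matter. *)
Definition endomorphism (A : finType) (X : set (config A))
    (phi : config A -> config A) : Prop :=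
  [/\ forall x, X x -> X (phi x),
      {within X, continuous phi} &
      forall x, X x -> phi (shiftZ 1 x) = shiftZ 1 (phi x)].

Definition compatible_metric (R : realType) (A : finType) (X : set (config A))
    (d : config A -> config A -> R) : Prop :=
  [/\ forall x y, X x -> X y -> 0 <= d x y,
      forall x y, X x -> X y -> (d x y = 0 <-> x = y),
      forall x y, X x -> X y -> d x y = d y x,
      forall x y z, X x -> X y -> X z -> d x z <= d x y + d y z &
      forall x (U : set (config A)), X x ->
        (within X (nbhs x) U <->
         exists2 e : R, 0 < e & forall y, X y -> d x y < e -> U y)].

Definition positively_expansive (R : realType) (A : finType)
    (X : set (config A)) (d : config A -> config A -> R)
    (phi : config A -> config A) : Prop :=
  exists2 delta : R, 0 < delta &
    forall x y, X x -> X y ->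
      (forall i : nat, d (iter i phi x) (iter i phi y) <= delta) -> x = y.

(* The word a_j ... a_(j+t-1). *)
Definition word (A : finType) (t : nat) (x : config A) (j : int) : t.-tuple A :=
  [tuple x (j + i%:Z) | i < t].

Definition language (A : finType) (X : set (config A)) (t : nat)
    : set (t.-tuple A) :=
  [set w | exists x j, X x /\ w = word t x j].

(* X^[t] is written over the ambient alphabet t.-tuple A, which contains
   L_t(X). *)
Definition higher_block (A : finType) (t : nat) (X : set (config A))
    : set (config (t.-tuple A)) :=
  (fun x : config A => (word t x : config (t.-tuple A))) @` X.
Arguments higher_block {A} t X.

(* phi^[t]: a point of X^[t] is decoded by reading the first letter of each
   block. *)
Definition higher_block_map (A : finType) (t : nat) (ht : (0 < t)%N)
    (phi : config A -> config A) (w : config (t.-tuple A))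
    : config (t.-tuple A) :=
  word t (phi (fun j => tnth (w j) (Ordinal ht))).

(* Local rules are total on words; only their values on L_(N+1)(X) matter, and
   membership of the image in X forces these into L_1(X). *)
Definition local_rule (A : finType) (X : set (config A)) (N : nat)
    (f : N.+1.-tuple A -> A) : Prop :=
  forall x, X x -> X (fun j => f (word N.+1 x j)).

Definition of_type (A : finType) (X : set (config A))
    (phi : config A -> config A) (m n N : nat) (f : N.+1.-tuple A -> A)
    : Prop :=
  [/\ (m + n)%N = N, local_rule X f &
      forall x, X x -> phi x = (fun j => f (word N.+1 x (j - m%:Z)))].

Definition right_mergible (A : finType) (X : set (config A)) (N : nat)
    (f : N.+1.-tuple A -> A) (k : nat) : Prop :=
  forall a b, X a -> X b ->
    (forall j : int, j <= 0 -> a j = b j) ->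
    (forall j : int, 1 <= j <= k%:Z + 1 ->
      f (word N.+1 a (j - N%:Z)) = f (word N.+1 b (j - N%:Z))) ->
    a 1 = b 1.

Definition left_mergible (A : finType) (X : set (config A)) (N : nat)
    (f : N.+1.-tuple A -> A) (k : nat) : Prop :=
  forall a b, X a -> X b ->
    (forall j : int, 0 <= j -> a j = b j) ->
    (forall j : int, 1 <= j <= k%:Z + 1 ->
      f (word N.+1 a (- j)) = f (word N.+1 b (- j))) ->
    a (- 1) = b (- 1).

(* "Strictly k": k is the least integer satisfying P, None standing for
   infinity when there is none. *)
Definition strictly (P : nat -> Prop) (k : option nat) : Prop :=
  match k with
  | Some k => P k /\ forall i : nat, P i -> (k <= i)%N
  | None => forall i : nat, ~ P i
  end.

Definition nat_minus (n : nat) (k : option nat) : \bar int :=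
  match k with
  | Some k => ((n%:Z - k%:Z)%:E)%E
  | None => (-oo)%E
  end.

(* The pair q is (Q_R(phi), Q_L(phi)). *)
Definition is_q_degrees (A : finType) (X : set (config A))
    (phi : config A -> config A) (q : \bar int * \bar int) : Prop :=
  (finite_set X /\ q = (+oo, +oo)%E) \/
  (infinite_set X /\
   exists m n N (f : N.+1.-tuple A -> A) (k l : option nat),
     [/\ of_type X phi m n f,
         strictly (right_mergible X f) k,
         strictly (left_mergible X f) l &
         q = (nat_minus n k, nat_minus m l)]).

(* Every endomorphism has exactly one such pair, so that the default value is
   irrelevant. *)
Definition q_degrees (A : finType) (X : set (config A))
    (phi : config A -> config A) : \bar int * \bar int :=
  xget (0, 0)%E [set q | is_q_degrees X phi q].

Definition Q_R (A : finType) (X : set (config A))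
    (phi : config A -> config A) : \bar int := (q_degrees X phi).1.
Definition Q_L (A : finType) (X : set (config A))
    (phi : config A -> config A) : \bar int := (q_degrees X phi).2.

Record digraph := Digraph {
  gvertex : finType;
  garc : finType;
  gini : garc -> gvertex;
  gter : garc -> gvertex }.

Definition paths (G : digraph) : set (config (garc G)) :=
  [set x | forall j : int, gter (x j : garc G) = gini (x (j + 1) : garc G)].
Arguments paths G : clear implicits.

Record graph_hom (Gamma G : digraph) := GraphHom {
  hom_arc : garc Gamma -> garc G;
  hom_vertex : gvertex Gamma -> gvertex G;
  hom_ini : forall a, gini (hom_arc a) = hom_vertex (gini a);
  hom_ter : forall a, gter (hom_arc a) = hom_vertex (gter a) }.

(* The 1-block map phi_h induced by a graph-homomorphism, and more generally by
   a map of symbols. *)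
Definition block_map (A B : finType) (e : A -> B) (x : config A) : config B :=
  fun j => e (x j).

Definition weakly_left_resolving (Gamma G : digraph) (h : graph_hom Gamma G)
    : Prop :=
  forall a b : garc Gamma,
    gter a = gter b -> hom_arc h a = hom_arc h b -> a = b.

Definition weakly_right_resolving (Gamma G : digraph) (h : graph_hom Gamma G)
    : Prop :=
  forall a b : garc Gamma,
    gini a = gini b -> hom_arc h a = hom_arc h b -> a = b.

Record textile_system := Textile {
  tex_Gamma : digraph;
  tex_G : digraph;
  tex_p : graph_hom tex_Gamma tex_G;
  tex_q : graph_hom tex_Gamma tex_G }.

Definition textile_weakly_q_biresolving (T : textile_system) : Prop :=
  weakly_left_resolving (tex_q T) /\ weakly_right_resolving (tex_q T).

(* In set-theoretic language phi_p(Z) = X makes the symbols of X arcs of G; here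
   they are identified with arcs through a map e injective on L_1(X).  The last
   clause is phi = phi_q o (phi_p|Z)^-1 under this identification. *)
Definition weakly_q_biresolving (A : finType) (X : set (config A))
    (phi : config A -> config A) : Prop :=
  exists (T : textile_system) (e : A -> garc (tex_G T))
         (Z : set (config (garc (tex_Gamma T)))),
    let phi_p := block_map (hom_arc (tex_p T)) in
    let phi_q := block_map (hom_arc (tex_q T)) in
    let eX := block_map e @` X in
    [/\ textile_weakly_q_biresolving T,
        (forall a b : A, language X [tuple a] -> language X [tuple b] ->
           e a = e b -> a = b),
        [/\ closed Z, shiftZ 1 @` Z = Z & Z `<=` paths (tex_Gamma T)],
        [/\ {in Z &, injective phi_p}, phi_p @` Z = eX & phi_q @` Z `<=` eX] &
        (forall x z, X x -> Z z -> phi_p z = block_map e x ->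
           phi_q z = block_map e (phi x))].

(* Main.v *)
Require Import Defs.
From mathcomp Require Import all_boot all_order all_algebra.
From mathcomp Require Import all_classical all_reals all_analysis.
From mathcomp Require Import zify lra.
Local Open Scope classical_set_scope.
Local Open Scope ring_scope.

Set Implicit Arguments.
Unset Strict Implicit.
Unset Printing Implicit Defensive.

Import Order.TTheory GRing.Theory Num.Theory.

(** The q-degrees are defined through a local rule, but they measure a property
    of the map alone.  Say that [phi] determines rightwards with slack [r] if
    two points which agree on the nonpositive coordinates, and whose images
    agree on the coordinates at most [1 - r], also agree at coordinate 1; let
    determining leftwards be the mirror image.  Both directions are treated at
    once by reading coordinates as [e * j] with [e = 1] or [e = -1]
    ([determines]).  For a rule of type [(m, n)], being [k] right-mergible means
    exactly determining rightwards with slack [n - k]; slack larger than [n]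
    would make the left half of a point determine the point, which forces [X]
    to be finite, and in a finite [X], where all points are periodic, every
    slack is possible.  Hence, in all cases, [r <= Q_R phi] if and only if [phi]
    determines rightwards with slack [r], and likewise for [Q_L] ([le_Q_R],
    [le_Q_L]).

    Composing with the shift moves the slack ([determines_comp_shift]), so for
    [psi = phi sigma^s] the condition [- Q_R phi <= s <= Q_L phi] says that
    [psi] determines in both directions with slack 0, and the strict
    inequalities say that it does so with slack 1.

    Slack 0 is biresolvability ([biresolvingP]).  If a textile system presents
    [psi^[t]], then [phi_p] restricted to [Z] has a block code as inverse, so
    that two points of [X] which agree on a half-line come from two paths which
    agree on a half-line; as long as the images agree too, the resolving property
    of [q] propagates the equality of the paths one arc at a time, and reading
    [phi_p] at the last arc gives the next letter.  Conversely, by compactness,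
    determination takes place within a window of bounded length [M]; the graph
    whose arcs are the pairs of words of length [M + 2] occurring at the same
    place in [x] and [psi x] is then resolving in both directions with respect
    to the second component.

    Slack 1 gives positive expansiveness ([determines_expansive]): if all
    iterates of two points agree on a long enough interval, then their
    iterates also agree on the interval enlarged by one coordinate on either
    side, hence everywhere; and closeness in the metric forces agreement on
    any prescribed interval.

    All passages to bounded windows rest on one compactness statement,
    [compact_pairs]. *)

(** * The topology of configuration spaces *)

Definition agree (A : finType) (n : nat) (x y : config A) :=
  forall j : int, - n%:Z <= j <= n%:Z -> x j = y j.

Lemma agreeW (A : finType) (m n : nat) (x y : config A) :
  (m <= n)%N -> agree n x y -> agree m x y.
Proof. by move=> mn xy j hj; apply: xy; lia. Qed.

Lemma agree_sym (A : finType) (n : nat) (x y : config A) :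
  agree n x y -> agree n y x.
Proof. by move=> xy j /xy ->. Qed.

Lemma agree_trans (A : finType) (n : nat) (x y z : config A) :
  agree n x y -> agree n y z -> agree n x z.
Proof. by move=> xy yz j hj; rewrite xy// yz. Qed.

Lemma eq_agree (A : finType) (x y : config A) :
  (forall n, agree n x y) -> x = y.
Proof. by move=> xy; apply/funext => j; apply: (xy `|j|%N); lia. Qed.

Lemma nbhs_coord (A : finType) (x : config A) (j : int) :
  nbhs x [set y : config A | y j = x j].
Proof.
have := @proj_continuous int (fun=> discrete_topology A) j x.
by move/(_ [set x j]); apply; apply: open_nbhs_nbhs; split=> //; exact: discrete_open.
Qed.

(** Apart from compactness, everything about the product topology is read off
    from this description of neighborhoods by central intervals. *)
Lemma nbhs_agree (A : finType) (x : config A) (U : set (config A)) :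
  nbhs x U <-> exists n, forall y, agree n x y -> U y.
Proof.
split; last first.
  case=> n nU; apply: filterS nU _; elim: n => [|n IH].
    by apply: filterS (nbhs_coord x 0) => y /= yx j hj; have -> : j = 0 by lia.
  apply: filterS3 (nbhs_coord x n.+1) (nbhs_coord x (- n.+1%:Z)) IH.
  move=> y /= y1 y2 IH j hj.
  have [->//|/eqP jn] := eqVneq j n.+1%:Z.
  have [->//|/eqP jn'] := eqVneq j (- n.+1%:Z).
  by apply: IH; lia.
pose F : set_system (config A) := filter_from setT (fun n => agree n x).
have FF : Filter F.
  apply: filter_from_filter; first by exists 0%N.
  move=> m n _ _; exists (maxn m n) => // y xy.
  by split; apply: agreeW xy; lia.
(* The filter generated by the central cylinders converges to [x] because it
   does so coordinatewise. *)
suff Fx : F --> x by move/Fx => [n _ nU]; exists n.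
apply/(@cvg_sup _ _ _ F x) => j; apply/cvg_image.
  by rewrite eqEsubset; split => // a _; exists (fun=> a).
move=> V xV; have Vx : V (x j) by exact: (nbhs_singleton xV).
exists ((fun y : config A => y j) @^-1` V).
  exists `|j|%N => // y xy /=; rewrite -xy//; lia.
by rewrite eqEsubset; split => [_ [y yV <-]//|a Va]; exists (fun=> a).
Qed.

(** * Compactness *)

Lemma closed_agreeP (A : finType) (X : set (config A)) :
  closed X <-> forall x, (forall n, exists2 y, X y & agree n x y) -> X x.
Proof.
split=> [clX x xX|clX x xX].
  apply: clX => U /nbhs_agree[n nU]; have [y Xy xy] := xX n.
  by exists y; split=> //; exact: nU.
apply: clX => n; have : nbhs x (agree n x) by apply/nbhs_agree; exists n.
by case/xX => y [Xy xy]; exists y.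
Qed.

Lemma config_compact (A : finType) : compact [set: config A].
Proof.
have := @tychonoff int (fun=> discrete_topology A) (fun=> setT).
have -> : [set f : forall i : int, discrete_topology A | forall i, setT (f i)]
   = setT by rewrite -subTset => f _ i.
by apply=> _; apply: finite_compact; exact: (@finite_finset A).
Qed.

(** Sequential compactness. Only [n <= h n] is kept from the monotonicity of a
    subsequence; this is stable under composing two extractions, which is how
    pairs of sequences are handled below. *)
Lemma closed_subseq (A : finType) (X : set (config A)) (u : nat -> config A) :
  closed X -> (forall n, X (u n)) ->
  exists x (h : nat -> nat),
    X x /\ forall n, (n <= h n)%N /\ agree n x (u (h n)).
Proof.
move=> clX Xu; have cX : compact X.
  exact: subclosed_compact clX (@config_compact A) _.
have [x [Xx clx]] : X `&` cluster (u @ \oo) !=set0.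
  by apply: cX; exists 0%N => // n _; exact: Xu.
exists x.
have hx n : exists m, (n <= m)%N /\ agree n x (u m).
  have [||y [[m nm <-] xy]] := clx (u @` [set m | (n <= m)%N]) (agree n x).
  - by exists n => // m nm; exists m.
  - by apply/nbhs_agree; exists n.
  by exists m.
by have [h hh] := choice hx; exists h.
Qed.

(** Relative openness of [P] in the product of [X] with itself. *)
Definition near_pairs (A : finType) (X : set (config A))
    (P : config A -> config A -> Prop) :=
  forall a b, X a -> X b -> P a b -> exists n, forall a' b',
    X a' -> X b' -> agree n a a' -> agree n b b' -> P a' b'.

(** If infinitely many closed conditions [C j] force an open conclusion [G],
    then finitely many of them do: otherwise a limit of counterexamples to the
    finite versions would satisfy all the conditions and violate [G]. *)
Lemma compact_pairs (A : finType) (X : set (config A))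
    (C : int -> config A -> config A -> Prop)
    (G : config A -> config A -> Prop) :
  closed X -> (forall j, near_pairs X (fun a b => ~ C j a b)) ->
  near_pairs X G ->
  (forall a b, X a -> X b -> (forall j, C j a b) -> G a b) ->
  exists M : nat, forall a b, X a -> X b ->
    (forall j, - M%:Z <= j <= M%:Z -> C j a b) -> G a b.
Proof.
move=> clX Copen Gopen CG; apply: contrapT => noM.
have bad M : exists ab : config A * config A, [/\ X ab.1, X ab.2,
    forall j, - M%:Z <= j <= M%:Z -> C j ab.1 ab.2 & ~ G ab.1 ab.2].
  apply: contrapT => nobad; apply: noM; exists M => a b Xa Xb Cab.
  by apply: contrapT => nG; apply: nobad; exists (a, b).
have [w wP] := choice bad.
have [|a [h [Xa hP]]] := @closed_subseq A X (fst \o w) clX.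
  by move=> n; case: (wP n).
have [|b [g [Xb gP]]] := @closed_subseq A X (snd \o w \o h) clX.
  by move=> n; case: (wP (h n)).
(* Both coordinates converge along the indices [h (g n)]. *)
pose k n := h (g n).
have kn n : (n <= k n)%N.
  by have [? _] := gP n; have [? _] := hP (g n); rewrite /k; lia.
have ka n : agree n a (w (k n)).1.
  by have [gn _] := gP n; have [_] := hP (g n); move/(agreeW gn).
have kb n : agree n b (w (k n)).2 by have [_] := gP n.
suff /CG - /(_ Xa Xb) /Gopen - /(_ Xa Xb) [n nG] : forall j, C j a b.
  case: (wP (k n)) => X1 X2 _; apply; exact: nG.
move=> j; apply: contrapT => /(Copen j a b Xa Xb) [n nC].
pose N := maxn n `|j|%N; have [X1 X2 + _] := wP (k N).
have := kn N => kN.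
move=> /(_ j) CN; apply: (nC _ _ X1 X2); last by apply: CN; lia.
- by apply: agreeW (ka N); lia.
- by apply: agreeW (kb N); lia.
Qed.

(** Local constancy is continuity for the discrete topology on [T]; relations
    between the values of such functions are both open and closed, which
    supplies the hypotheses of [compact_pairs]. *)
Definition loc_const (A : finType) (X : set (config A)) (T : Type)
    (F : config A -> T) :=
  forall a, X a -> exists n, forall a', X a' -> agree n a a' -> F a' = F a.

Lemma loc_const_coord (A : finType) (X : set (config A)) (j : int) :
  loc_const X (fun a => a j).
Proof. by move=> a _; exists `|j|%N => a' _ /(_ j) ->//; lia. Qed.

Lemma loc_const_pair (A : finType) (X : set (config A)) (T T' : Type)
    (F : config A -> T) (F' : config A -> T') :
  loc_const X F -> loc_const X F' -> loc_const X (fun a => (F a, F' a)).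
Proof.
move=> cF cF' a Xa; have [n nF] := cF a Xa; have [m mF] := cF' a Xa.
exists (maxn m n) => a' Xa' aa'; rewrite nF ?mF//; apply: agreeW aa'; lia.
Qed.

Lemma near_pairs_loc_const (A : finType) (X : set (config A)) (T : Type)
    (F : config A -> T) (Q : T -> T -> Prop) :
  loc_const X F -> near_pairs X (fun a b => Q (F a) (F b)).
Proof.
move=> cF a b Xa Xb Qab; have [n nF] := cF a Xa; have [m mF] := cF b Xb.
exists (maxn m n) => a' b' Xa' Xb' aa' bb'.
have -> : F a' = F a by apply: nF => //; apply: agreeW aa'; lia.
by have -> : F b' = F b by apply: mF => //; apply: agreeW bb'; lia.
Qed.

Lemma continuous_agree (A : finType) (X : set (config A))
    (phi : config A -> config A) (x : config A) (n : nat) :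
  {within X, continuous phi} -> X x ->
  exists m, forall y, X y -> agree m x y -> agree n (phi x) (phi y).
Proof.
move=> /subspace_continuousP cphi Xx.
have n_nbhs : nbhs (phi x) (agree n (phi x)) by apply/nbhs_agree; exists n.
have /nbhs_agree[m mP] := cphi x Xx _ n_nbhs.
by exists m => y Xy xy; exact: mP.
Qed.

Lemma loc_const_continuous (A : finType) (X : set (config A))
    (phi : config A -> config A) (j : int) :
  {within X, continuous phi} -> loc_const X (fun a => phi a j).
Proof.
move=> cphi a Xa; have [n nP] := continuous_agree `|j| cphi Xa.
by exists n => a' Xa' /(nP _ Xa') -> //; lia.
Qed.

(** * Words, shifts and determination in one direction *)

Lemma word_nth (A : finType) (t : nat) (x : config A) (p : int) (i : 'I_t) :
  tnth (word t x p) i = x (p + i%:Z).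
Proof. by rewrite tnth_mktuple. Qed.

Lemma eq_word (A : finType) (t : nat) (x y : config A) (p : int) :
  word t x p = word t y p <->
  forall j, p <= j < p + t%:Z -> x j = y j.
Proof.
split=> [xy j hj|xy].
  have ht : (`|j - p|%N < t)%N by lia.
  have := congr1 (fun w => tnth w (Ordinal ht)) xy; rewrite !word_nth /=.
  by have -> : p + `|j - p|%N%:Z = j by lia.
by apply: eq_from_tnth => i; rewrite !word_nth; apply: xy; have := ltn_ord i; lia.
Qed.

Lemma shiftZD (A : finType) (r s : int) (x : config A) :
  shiftZ r (shiftZ s x) = shiftZ (r + s) x.
Proof. by apply/funext => j; rewrite /shiftZ addrA. Qed.

Lemma shiftZ0 (A : finType) (x : config A) : shiftZ 0 x = x.
Proof. by apply/funext => j; rewrite /shiftZ addr0. Qed.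

Lemma subshift_shift (A : finType) (X : set (config A)) (s : int)
    (x : config A) :
  shiftZ 1 @` X = X -> X x -> X (shiftZ s x).
Proof.
move=> sX; have s1 y : X y -> X (shiftZ 1 y) by move=> Xy; rewrite -sX; exists y.
have sN1 y : X y -> X (shiftZ (- 1) y).
  by rewrite -{1}sX => -[z Xz <-]; rewrite shiftZD addNr shiftZ0.
move=> Xx; suff H n : X (shiftZ n%:Z x) /\ X (shiftZ (- n%:Z) x).
  by case: (intP s) => [|n|n]; [case: (H 0%N)|case: (H n.+1)|case: (H n.+1)].
elim: n => [|n [IH1 IH2]]; first by rewrite oppr0 shiftZ0.
split.
- by have := s1 _ IH1; rewrite shiftZD; congr (X (shiftZ _ x)); lia.
- by have := sN1 _ IH2; rewrite shiftZD; congr (X (shiftZ _ x)); lia.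
Qed.

Lemma endomorphism_shift (A : finType) (X : set (config A))
    (phi : config A -> config A) (s : int) (x : config A) :
  shiftZ 1 @` X = X -> endomorphism X phi -> X x ->
  phi (shiftZ s x) = shiftZ s (phi x).
Proof.
move=> sX [_ _ s1] Xx.
have Xs r : X (shiftZ r x) by exact: subshift_shift.
suff H n : phi (shiftZ n%:Z x) = shiftZ n%:Z (phi x) /\
    phi (shiftZ (- n%:Z) x) = shiftZ (- n%:Z) (phi x).
  by case: (intP s) => [|n|n]; [case: (H 0%N)|case: (H n.+1)|case: (H n.+1)].
elim: n => [|n [IH1 IH2]]; first by rewrite oppr0 !shiftZ0.
split.
- have -> : n.+1%:Z = 1 + n%:Z by lia.
  by rewrite -!shiftZD s1// IH1.
- have h : - n%:Z = 1 + - n.+1%:Z by lia.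
  apply: (@can_inj _ _ (shiftZ 1) (shiftZ (-1))).
    by move=> y; rewrite shiftZD addNr shiftZ0.
  by rewrite -s1// !shiftZD -h.
Qed.

Lemma endomorphism_id (A : finType) (X : set (config A)) : endomorphism X id.
Proof. by split=> //; apply: continuous_subspaceT => x. Qed.

(** The known half-line consists of the coordinates [e * j] with [j <= 0], and
    [e] is the next one: the direction is rightwards for [e = 1], leftwards for
    [e = -1]. A larger [r] grants less knowledge of the images, so it makes the
    property stronger. *)
Definition determines (A : finType) (X : set (config A))
    (phi : config A -> config A) (e r : int) :=
  forall a b, X a -> X b ->
    (forall j : int, j <= 0 -> a (e * j) = b (e * j)) ->
    (forall j : int, j <= 1 - r -> phi a (e * j) = phi b (e * j)) ->
    a e = b e.

Lemma determinesW (A : finType) (X : set (config A))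
    (phi : config A -> config A) (e r r' : int) :
  r' <= r -> determines X phi e r -> determines X phi e r'.
Proof.
move=> rr' D a b Xa Xb ab pab; apply: D => // j hj; apply: pab; lia.
Qed.

(** By compactness a half-line may be replaced by a bounded interval, and by
    shift-invariance the interval may sit anywhere. The bound is stated for all
    [m] above a threshold so that the two directions can share one window. *)
Lemma determines_window (A : finType) (X : set (config A))
    (phi : config A -> config A) (e r : int) :
  subshift X -> endomorphism X phi -> determines X phi e r ->
  exists M : nat, forall m : nat, (M <= m)%N -> forall a b (i : int), X a -> X b ->
    (forall j : int, - m%:Z <= j <= 0 -> a (i + e * j) = b (i + e * j)) ->
    (forall j : int, - m%:Z <= j <= 1 - r ->
       phi a (i + e * j) = phi b (i + e * j)) ->
    a (i + e) = b (i + e).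
Proof.
move=> [clX sX] Hphi D; have [_ cphi _] := Hphi.
pose C j a b := (j <= 0 -> a (e * j) = b (e * j)) /\
  (j <= 1 - r -> phi a (e * j) = phi b (e * j)).
have [|||M MP] := @compact_pairs A X C (fun a b => a e = b e) clX.
- move=> j.
  exact: (@near_pairs_loc_const _ _ _ (fun a => (a (e * j), phi a (e * j)))
    (fun u v => ~ ((j <= 0 -> u.1 = v.1) /\ (j <= 1 - r -> u.2 = v.2)))
    (loc_const_pair (@loc_const_coord _ _ _) (loc_const_continuous _ cphi))).
- exact: (@near_pairs_loc_const _ _ _ _ eq (@loc_const_coord _ _ _)).
- by move=> a b Xa Xb Cab; apply: D => // j hj; [apply: (Cab j).1|apply: (Cab j).2].
exists M => m Mm a b i Xa Xb ab pab.
rewrite [i + e]addrC; apply: (MP (shiftZ i a) (shiftZ i b)).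
- exact: subshift_shift.
- exact: subshift_shift.
move=> j hj; split=> hj'; first by rewrite /shiftZ addrC; apply: ab; lia.
by rewrite !(endomorphism_shift _ sX Hphi)// /shiftZ addrC; apply: pab; lia.
Qed.

(** When half of a point determines the rest, a block of [M + 1] consecutive
    letters determines everything beyond it. More points than there are such
    blocks, separated by a central interval of radius [n], would have pairwise
    different blocks ending at [- n] (read in direction [e]), which is
    absurd. *)
Lemma determines_id_finite (A : finType) (X : set (config A)) (e : int) :
  (e = 1 \/ e = -1) -> subshift X -> determines X id e 1 -> finite_set X.
Proof.
move=> e1 sX /(determines_window sX (endomorphism_id X))[M /(_ M (leqnn M)) D].
have D' (m : nat) a b (i : int) : X a -> X b ->
    (forall j : int, - M%:Z <= j <= 0 -> a (i + e * j) = b (i + e * j)) ->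
    a (i + e * m%:Z) = b (i + e * m%:Z).
  move=> Xa Xb; elim: m i => [|m IH] i ab; first by apply: ab; lia.
  have step j : i + e + e * j = i + e * (j + 1).
    by rewrite mulrDr mulr1 [e * j + e]addrC addrA.
  have -> : i + e * m.+1%:Z = i + e + e * m%:Z
    by rewrite step intS; congr (_ + _ * _); lia.
  apply: IH => j hj; rewrite step.
  have [->|/eqP j0] := eqVneq j 0; last by apply: ab; lia.
  by rewrite add0r mulr1; apply: D => // k hk; apply: ab; lia.
apply: contrapT => /(@infinite_set_fset (config A) _ #|{: M.+1.-tuple A}|.+1).
move=> [B BX sB].
have [x0 Bx0] : exists x, x \in finmap.enum_fset B.
  by case: (finmap.enum_fset B) sB => // x s _; exists x; rewrite mem_head.
pose u (i : 'I_(#|{: M.+1.-tuple A}|.+1)) : config A :=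
  nth x0 (finmap.enum_fset B) i.
have iB (i : 'I_(#|{: M.+1.-tuple A}|.+1)) : (i < size (finmap.enum_fset B))%N.
  exact: leq_trans (ltn_ord i) sB.
have Xu i : X (u i) by apply: BX; exact: mem_nth.
have u_inj : injective u.
  move=> i j /eqP; rewrite nth_uniq ?finmap.fset_uniq// => /eqP ij.
  exact: val_inj.
have /choice[f fP] : forall p, exists n,
    agree n (u p.1) (u p.2) -> p.1 = p.2.
  move=> [i j] /=; apply: contrapT => nij.
  have /u_inj ij : u i = u j.
    apply: eq_agree => n; apply: contrapT => nn.
    by apply: nij; exists n => /nn.
  by apply: nij; exists 0%N.
(* On the interval from [- n] to [n] the points [u i] are pairwise distinct. *)
pose n := \max_p f p.
(* The block of length [M + 1] that ends, in direction [e], at [- n]. *)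
pose g i : M.+1.-tuple A := [tuple u i (e * (- n%:Z - k%:Z)) | k < M.+1].
suff /leq_card : injective g by rewrite card_ord ltnn.
move=> i j gij; apply: (fP (i, j)) => /= p hp.
have fn : (f (i, j) <= n)%N by exact: leq_bigmax.
have [m pm] : exists m : nat, p = e * - n%:Z + e * m%:Z.
  by exists `|(e * p + n%:Z)%R|%N; case: e1 => ->; lia.
rewrite pm; apply: D' => // k hk.
have hk' : (`|k|%N < M.+1)%N by lia.
have := congr1 (fun w => tnth w (Ordinal hk')) gij; rewrite !tnth_mktuple /=.
by have -> : e * (- n%:Z - `|k|%N%:Z) = e * - n%:Z + e * k
  by rewrite -mulrDr; congr (_ * _); lia.
Qed.

Lemma finite_periodic (A : finType) (X : set (config A)) (a : config A) :
  finite_set X -> shiftZ 1 @` X = X -> X a ->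
  exists2 p : nat, (0 < p)%N & forall j, a (j + p%:Z) = a j.
Proof.
move=> fX sX Xa; apply: contrapT => np.
pose u (n : nat) : config A := shiftZ n%:Z a.
apply: infinite_nat; have -> : [set: nat] = u @^-1` X.
  by apply/esym; rewrite -subTset => n _; exact: subshift_shift.
apply: finite_preimage fX => m n _ _.
wlog mn : m n / (m < n)%N.
  move=> W; case: (ltngtP m n) => // h umn; first exact: W h umn.
  by apply/esym/W.
move=> umn; exfalso; apply: np; exists (n - m)%N; first by lia.
move=> j; have /(congr1 (fun x : config A => x (j - m%:Z))) := umn.
by rewrite /u /shiftZ subrK => ->; congr (a _); lia.
Qed.

(** Points of a finite subshift are periodic, and two points have a common
    period, so a half-line determines both of them. *)
Lemma finite_determines (A : finType) (X : set (config A))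
    (phi : config A -> config A) (e r : int) :
  (e = 1 \/ e = -1) -> finite_set X -> shiftZ 1 @` X = X ->
  determines X phi e r.
Proof.
move=> e1 fX sX a b Xa Xb ab _.
have [p p0 ap] := finite_periodic fX sX Xa.
have [q q0 bq] := finite_periodic fX sX Xb.
have per (x : config A) (s : nat) : (forall j, x (j + s%:Z) = x j) ->
    forall (m : nat) j, x (j + (m * s)%N%:Z) = x j.
  move=> xs; elim=> [|m IH] j; first by rewrite mul0n addr0.
  by rewrite mulSn PoszD addrA IH xs.
have ap' := per a p ap q; have bq' := per b q bq p.
have pq : (0 < p * q)%N by rewrite muln_gt0 p0.
pose c := (p * q)%N%:Z.
have ac j : a (j + c) = a j by rewrite -(ap' j) /c mulnC.
case: e1 ab => -> ab.
- rewrite -(subrK c 1) ac bq'.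
  by have := ab (1 - c); rewrite mul1r; apply; rewrite /c; lia.
- rewrite -ac -(bq' (-1)) -/c.
  have := ab (1 - c); rewrite mulN1r opprB addrC; apply; rewrite /c; lia.
Qed.

(** * The q-degrees as thresholds of determination *)

Lemma of_type_local (A : finType) (X : set (config A))
    (phi : config A -> config A) (m n N : nat) (f : N.+1.-tuple A -> A)
    (a b : config A) (j : int) :
  of_type X phi m n f -> X a -> X b ->
  (forall i : int, j - m%:Z <= i <= j + n%:Z -> a i = b i) ->
  phi a j = phi b j.
Proof.
move=> [mnN _ phif] Xa Xb ab; rewrite !phif//; congr (f _).
by apply/eq_word => i hi; apply: ab; lia.
Qed.

(** The Curtis-Hedlund-Lyndon theorem: by compactness the letter at 0 of the
    image depends on a central block only. *)
Lemma endomorphism_of_type (A : finType) (X : set (config A))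
    (phi : config A -> config A) :
  subshift X -> endomorphism X phi ->
  exists m n N (f : N.+1.-tuple A -> A), of_type X phi m n f.
Proof.
move=> [clX sX] Hphi; have [Xphi cphi _] := Hphi.
have [|||M MP] := @compact_pairs A X (fun j a b => a j = b j)
    (fun a b => phi a 0 = phi b 0) clX.
- move=> j; exact: (@near_pairs_loc_const _ _ _ _ (fun u v => ~ u = v)
    (@loc_const_coord _ _ _)).
- exact: (@near_pairs_loc_const _ _ _ _ eq (loc_const_continuous 0 cphi)).
- by move=> a b _ _ ab; congr (phi _ 0); apply/funext.
have [f fP] : exists f : (M + M).+1.-tuple A -> A, forall x, X x ->
    f (word (M + M).+1 x (- M%:Z)) = phi x 0.
  suff /choice[f fP] : forall w : (M + M).+1.-tuple A, exists c : A,
      forall x, X x -> w = word (M + M).+1 x (- M%:Z) -> c = phi x 0.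
    by exists f => x Xx; exact: fP.
  move=> w; have [[x [Xx wx]]|nx] := pselect (exists x, X x /\
      w = word (M + M).+1 x (- M%:Z)).
    exists (phi x 0) => y Xy; rewrite wx => /eq_word xy.
    by apply: MP => // j hj; apply: xy; lia.
  (* An arbitrary value on words that do not occur in [X]. *)
  exists (tnth w ord0) => x Xx wx; exfalso; apply: nx; by exists x.
have phif x : X x -> phi x = (fun j => f (word (M + M).+1 x (j - M%:Z))).
  move=> Xx; apply/funext => j.
  have Xj : X (shiftZ j x) by exact: subshift_shift.
  have -> : phi x j = phi (shiftZ j x) 0.
    by rewrite (endomorphism_shift _ sX Hphi)// /shiftZ add0r.
  rewrite -fP//; congr f; apply: eq_from_tnth => i; rewrite !word_nth /shiftZ.
  by congr (x _); lia.
exists M, M, (M + M)%N, f; split=> // x Xx.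
have : X (shiftZ M%:Z (phi x)) by apply: subshift_shift => //; exact: Xphi.
rewrite phif//; congr (X _); apply/funext => j.
by rewrite /shiftZ addrK.
Qed.

(** Under a rule of type [(m, n)], the letter computed from the word ending at
    [j] is the letter of the image at [j - n]. The images of two points that
    agree on the nonpositive coordinates agree up to [- n] anyway, so only the
    coordinates from [1 - n] to [k + 1 - n] matter. *)
Lemma right_mergible_determines (A : finType) (X : set (config A))
    (phi : config A -> config A) (m n N k : nat) (f : N.+1.-tuple A -> A) :
  of_type X phi m n f ->
  right_mergible X f k <-> determines X phi 1 (n%:Z - k%:Z).
Proof.
move=> tf; have [mnN _ phif] := tf.
have fE x j : X x -> f (word N.+1 x (j - N%:Z)) = phi x (j - n%:Z).
  by move=> Xx; rewrite phif//; congr (f (word _ _ _)); lia.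
split=> [rm|D] a b Xa Xb ab fab.
  apply: rm => // j hj; first by have := ab j hj; rewrite mul1r.
  by rewrite !fE//; have := fab (j - n%:Z); rewrite mul1r; apply; lia.
apply: D => // j hj; rewrite mul1r; first exact: ab.
have [jn|jn] := lerP j (- n%:Z).
  by apply: of_type_local tf Xa Xb _ => i hi; apply: ab; lia.
by have := fab (j + n%:Z); rewrite !fE// addrK; apply; lia.
Qed.

Lemma left_mergible_determines (A : finType) (X : set (config A))
    (phi : config A -> config A) (m n N k : nat) (f : N.+1.-tuple A -> A) :
  of_type X phi m n f ->
  left_mergible X f k <-> determines X phi (-1) (m%:Z - k%:Z).
Proof.
move=> tf; have [mnN _ phif] := tf.
have fE x j : X x -> f (word N.+1 x (- j)) = phi x (m%:Z - j).
  by move=> Xx; rewrite phif//; congr (f (word _ _ _)); lia.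
split=> [lm|D] a b Xa Xb ab fab.
  apply: lm => // j hj.
    by have := ab (- j); rewrite mulN1r opprK; apply; lia.
  rewrite !fE//; have -> : m%:Z - j = -1 * (j - m%:Z) by lia.
  by apply: fab; lia.
apply: D => // j hj; rewrite mulN1r; first by apply: ab; lia.
have [jn|jn] := lerP j (- m%:Z).
  by apply: of_type_local tf Xa Xb _ => i hi; apply: ab; lia.
have -> : - j = m%:Z - (j + m%:Z) by lia.
by rewrite -!fE//; apply: fab; lia.
Qed.

Lemma strictly_exists (P : nat -> Prop) : exists k, strictly P k.
Proof.
have [[n Pn]|nP] := pselect (exists n, P n); last first.
  by exists None => i Pi; apply: nP; exists i.
have exP : exists n, `[< P n >] by exists n; apply/asboolP.
exists (Some (ex_minn exP)); case: ex_minnP => k /asboolP Pk kmin.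
by split=> // i Pi; apply: kmin; apply/asboolP.
Qed.

(** The slacks [n - i], for natural [i], are all the integers at most [n]; when
    no larger slack is possible, the least mergibility index [k] gives the
    largest slack [n - k]. *)
Lemma le_nat_minus (P : nat -> Prop) (D : int -> Prop) (n : nat)
    (k : option nat) (r : int) :
  (forall i : nat, P i <-> D (n%:Z - i%:Z)) ->
  (forall r r' : int, r' <= r -> D r -> D r') ->
  (forall r : int, D r -> r <= n%:Z) ->
  strictly P k -> (r%:E <= nat_minus n k)%E <-> D r.
Proof.
move=> PD Dmono Dn sk.
have DP : D r -> exists2 i : nat, P i & r = n%:Z - i%:Z.
  move=> Dr; have rn := Dn _ Dr; exists `|n%:Z - r|%N; last by lia.
  apply/PD; move: Dr; congr (D _); lia.
case: k sk => [k [Pk kmin]|nP] /=.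
  rewrite lee_fin; split=> [rk|/DP[i /kmin ki ->]]; last by lia.
  by apply: Dmono rk _; apply/PD.
by split=> [|/DP[i /nP]//]; rewrite leeNy_eq.
Qed.

(** With slack beyond [c], the hypothesis on images holds for any two points
    that agree on the half-line, so the half-line alone determines the next
    letter. *)
Lemma determines_bound (A : finType) (X : set (config A))
    (phi : config A -> config A) (e r : int) (c : nat) :
  (e = 1 \/ e = -1) -> subshift X -> infinite_set X ->
  (forall a b, X a -> X b -> (forall j, j <= 0 -> a (e * j) = b (e * j)) ->
     forall j, j <= - c%:Z -> phi a (e * j) = phi b (e * j)) ->
  determines X phi e r -> r <= c%:Z.
Proof.
move=> e1 sX iX loc D; case: lerP => // cr; exfalso; apply: iX.
apply: (determines_id_finite e1) => // a b Xa Xb ab _; apply: D => // j hj.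
by apply: loc => //; lia.
Qed.

(** Since this holds for every pair satisfying [is_q_degrees], independence of
    the rule and of its type need not be established separately. *)
Lemma le_q_degrees (A : finType) (X : set (config A))
    (phi : config A -> config A) (q : \bar int * \bar int) (r : int) :
  subshift X -> endomorphism X phi -> is_q_degrees X phi q ->
  ((r%:E <= q.1)%E <-> determines X phi 1 r) /\
  ((r%:E <= q.2)%E <-> determines X phi (-1) r).
Proof.
move=> sX Hphi [[fX ->]|[iX [m [n [N [f [k [l [tf sk sl ->]]]]]]]]] /=.
  rewrite !leey; split; split=> // _.
  - by apply: finite_determines => //; [left|case: sX].
  - by apply: finite_determines => //; [right|case: sX].
split.
- apply: le_nat_minus sk => [i|r1 r2|r1]; first exact: (right_mergible_determines _ tf).
    exact: determinesW.
  apply: determines_bound => //; first by left.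
  move=> a b Xa Xb ab j hj; rewrite mul1r.
  apply: (of_type_local tf Xa Xb).
  by move=> i hi; have := ab i; rewrite mul1r; apply; lia.
- apply: le_nat_minus sl => [i|r1 r2|r1]; first exact: (left_mergible_determines _ tf).
    exact: determinesW.
  apply: determines_bound => //; first by right.
  move=> a b Xa Xb ab j hj; rewrite mulN1r.
  apply: (of_type_local tf Xa Xb).
  by move=> i hi; have := ab (- i); rewrite mulN1r opprK; apply; lia.
Qed.

Lemma q_degreesP (A : finType) (X : set (config A))
    (phi : config A -> config A) :
  subshift X -> endomorphism X phi -> is_q_degrees X phi (q_degrees X phi).
Proof.
move=> sX Hphi; apply: (@xgetPex _ _ [set q | is_q_degrees X phi q]).
have [fX|iX] := pselect (finite_set X); first by exists (+oo, +oo)%E; left.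
have [m [n [N [f tf]]]] := endomorphism_of_type sX Hphi.
have [k sk] := strictly_exists (right_mergible X f).
have [l sl] := strictly_exists (left_mergible X f).
by exists (nat_minus n k, nat_minus m l); right; split=> //; exists m, n, N, f, k, l.
Qed.

Lemma le_Q_R (A : finType) (X : set (config A))
    (phi : config A -> config A) (r : int) :
  subshift X -> endomorphism X phi ->
  (r%:E <= Q_R X phi)%E <-> determines X phi 1 r.
Proof.
by move=> sX Hphi; have [] := le_q_degrees r sX Hphi (q_degreesP sX Hphi).
Qed.

Lemma le_Q_L (A : finType) (X : set (config A))
    (phi : config A -> config A) (r : int) :
  subshift X -> endomorphism X phi ->
  (r%:E <= Q_L X phi)%E <-> determines X phi (-1) r.
Proof.
by move=> sX Hphi; have [] := le_q_degrees r sX Hphi (q_degreesP sX Hphi).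
Qed.

Lemma endomorphism_comp_shift (A : finType) (X : set (config A))
    (phi : config A -> config A) (s : int) :
  subshift X -> endomorphism X phi -> endomorphism X (phi \o shiftZ s).
Proof.
move=> [_ sX] Hphi; have [Xphi cphi phi1] := Hphi.
have Xs r x : X x -> X (shiftZ r x) by exact: subshift_shift.
split=> [x Xx||x Xx] /=; first by apply: Xphi; exact: Xs.
  apply/subspace_continuousP => x Xx U /nbhs_agree[n nU].
  have [k kP] := continuous_agree (n + `|s|) cphi Xx.
  apply/nbhs_agree; exists k => y xy Xy; apply: nU => j hj.
  change (phi (shiftZ s x) j = phi (shiftZ s y) j).
  by rewrite !(endomorphism_shift _ sX Hphi)// /shiftZ; apply: (kP y) => //; lia.
by rewrite -phi1 /=; [rewrite !shiftZD addrC|exact: Xs].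
Qed.

(** At [e * j] the composite reads the image at [e * (j + e * s)], because
    [e * e = 1]. *)
Lemma determines_comp_shift (A : finType) (X : set (config A))
    (phi : config A -> config A) (s e r : int) :
  (e = 1 \/ e = -1) -> subshift X -> endomorphism X phi ->
  determines X (phi \o shiftZ s) e r <-> determines X phi e (r - e * s).
Proof.
move=> e1 [_ sX] Hphi.
have E x j : X x -> (phi \o shiftZ s) x (e * j) = phi x (e * (j + e * s)).
  move=> Xx /=; rewrite (endomorphism_shift _ sX Hphi)// /shiftZ.
  by congr (phi x _); case: e1 => ->; lia.
split=> D a b Xa Xb ab pab; apply: D => // j hj.
  by rewrite !E//; apply: pab; lia.
have <- : j - e * s + e * s = j by rewrite subrK.
by rewrite -!E//; apply: pab; lia.
Qed.

(** * Positive expansiveness *)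

(** A Lebesgue number argument. The conditions [d a b <= 1 / (`|j| + 1)] are
    closed by the triangle inequality, and together they force [a = b]. *)
Lemma compatible_metric_agree (R : realType) (A : finType) (X : set (config A))
    (d : config A -> config A -> R) (n : nat) :
  closed X -> compatible_metric X d ->
  exists2 delta : R, 0 < delta &
    forall x y, X x -> X y -> d x y <= delta -> agree n x y.
Proof.
move=> clX [d0 dE dC dT dnbhs].
have ball x (e : R) : X x -> 0 < e ->
    exists k, forall y, X y -> agree k x y -> d x y < e.
  move=> Xx e0; have : within X (nbhs x) [set y | d x y < e].
    by apply/dnbhs => //; exists e.
  by move/nbhs_agree => [k kP]; exists k => y Xy xy; exact: kP.
have [|||M MP] := @compact_pairs A X
  (fun j a b => d a b <= (`|j|%N.+1%:R)^-1) (agree n) clX.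
- move=> j a b Xa Xb /negP; rewrite -ltNge; set c := _^-1 => cab.
  have e0 : 0 < (d a b - c) / 2 by rewrite divr_gt0// subr_gt0.
  have [k kP] := ball a _ Xa e0; have [l lP] := ball b _ Xb e0.
  exists (maxn k l) => a' b' Xa' Xb' aa' bb'; apply/negP; rewrite -ltNge.
  have da : d a a' < (d a b - c) / 2 by apply: kP => //; apply: agreeW aa'; lia.
  have db : d b b' < (d a b - c) / 2 by apply: lP => //; apply: agreeW bb'; lia.
  have := dT a a' b Xa Xa' Xb; have := dT a' b' b Xa' Xb' Xb.
  by rewrite (dC b' b)//; lra.
- move=> a b _ _ ab; exists n => a' b' _ _ aa' bb'.
  by apply: agree_trans bb'; apply: agree_trans ab; exact: agree_sym.
- move=> a b Xa Xb Cab; suff -> : a = b by [].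
  apply/dE => //; apply/eqP; rewrite eq_le d0// andbT leNgt; apply/negP => dab.
  have [k] := ltr_add_invr dab; rewrite add0r => kd.
  by have := Cab k%:Z; rewrite absz_nat => /(lt_le_trans kd); rewrite ltxx.
exists (M.+1%:R^-1); first by rewrite invr_gt0.
move=> x y Xx Xy dxy; apply: MP => // j hj; apply: (le_trans dxy).
by rewrite lef_pV2 ?posrE// ler_nat; lia.
Qed.

(** Slack 1 uses the points and their images on the same half-line, so
    agreement of the [i]-th and [i.+1]-th iterates on an interval yields
    agreement of the [i]-th iterates one step further on either side. *)
Lemma determines_expansive (R : realType) (A : finType) (X : set (config A))
    (d : config A -> config A -> R) (psi : config A -> config A) :
  subshift X -> compatible_metric X d -> endomorphism X psi ->
  determines X psi 1 1 -> determines X psi (-1) 1 ->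
  positively_expansive X d psi.
Proof.
move=> sX dX Hpsi /(determines_window sX Hpsi)[M1 D1].
move=> /(determines_window sX Hpsi)[M2 D2].
pose M := maxn M1 M2; have [clX _] := sX; have [Xpsi _ _] := Hpsi.
have [delta delta0 dP] := compatible_metric_agree M clX dX.
exists delta => // x y Xx Xy dxy.
have Xi i z : X z -> X (iter i psi z) by elim: i => //= i IH /IH; exact: Xpsi.
suff H m i : agree (M + m) (iter i psi x) (iter i psi y).
  by apply: eq_agree => n; apply: agreeW (H n 0%N); exact: leq_addl.
elim: m i => [|m IH] i; first by rewrite addn0; apply: dP; [exact: Xi..|].
have Xx' := Xi i x Xx; have Xy' := Xi i y Xy => j hj.
have [jm|jm] := lerP `|j| (M + m)%N%:Z; first by apply: IH; lia.
have [j0|j0] := lerP 0 j.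
- have -> : j = (M + m)%N%:Z + 1 by lia.
  apply: (D1 M) => [|//|//|k hk|k hk]; first exact: leq_maxl.
  + by apply: IH; lia.
  + by apply: (IH i.+1); lia.
- have -> : j = - (M + m)%N%:Z + -1 by lia.
  apply: (D2 M) => [|//|//|k hk|k hk]; first exact: leq_maxr.
  + by apply: IH; lia.
  + by apply: (IH i.+1); lia.
Qed.

(** * From a biresolving textile system to determination *)

Lemma higher_block_map_word (A : finType) (t : nat) (ht : (0 < t)%N)
    (phi : config A -> config A) (x : config A) :
  higher_block_map ht phi (word t x) = word t (phi x).
Proof.
rewrite /higher_block_map; congr (word t (phi _)).
by apply/funext => j; rewrite word_nth /= addr0.
Qed.

Lemma word_inj (A : finType) (t : nat) : (0 < t)%N ->
  injective (fun x : config A => word t x : config (t.-tuple A)).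
Proof.
move=> t0 x y xy; apply/funext => j.
by have /eq_word := congr1 (fun w : config (t.-tuple A) => w j) xy; apply; lia.
Qed.

(** The inverse of an injective block map on a closed shift-invariant set is
    again given by a block code. *)
Lemma injective_block_map_window (B C : finType) (Z : set (config B))
    (p : B -> C) :
  closed Z -> shiftZ 1 @` Z = Z -> {in Z &, injective (block_map p)} ->
  exists M : nat, forall z z' (i : int), Z z -> Z z' ->
    (forall j : int, i - M%:Z <= j <= i + M%:Z -> p (z j) = p (z' j)) ->
    z i = z' i.
Proof.
move=> clZ sZ pinj.
have [|||M MP] := @compact_pairs B Z (fun j z z' => p (z j) = p (z' j))
    (fun z z' => z 0 = z' 0) clZ.
- move=> j; exact: (@near_pairs_loc_const _ _ _ _ (fun u v => ~ p u = p v)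
    (@loc_const_coord _ _ _)).
- exact: (@near_pairs_loc_const _ _ _ _ eq (@loc_const_coord _ _ _)).
- move=> z z' Zz Zz' pzz'; rewrite (pinj z z') ?inE//.
  by apply/funext => j; exact: pzz'.
exists M => z z' i Zz Zz' zz'.
suff : shiftZ i z 0 = shiftZ i z' 0 by rewrite /shiftZ !add0r.
apply: MP; [exact: subshift_shift..|].
by move=> j hj; apply: zz'; lia.
Qed.

(** Two points agreeing on a half-line lift to two paths in [Z] that agree on a
    half-line; the resolving property of [q] then extends the agreement of the
    paths as far as the images agree. *)
Lemma biresolving_determines (A : finType) (X : set (config A)) (t : nat)
    (ht : (0 < t)%N) (psi : config A -> config A) :
  weakly_q_biresolving (higher_block t X) (higher_block_map ht psi) ->
  determines X psi 1 0 /\ determines X psi (-1) 0.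
Proof.
case=> T [e [Z [[wl wr] e_inj [clZ sZ Zp] [p_inj pZ _] pq]]].
have e_inj_word x y i : X x -> X y -> e (word t x i) = e (word t y i) ->
    word t x i = word t y i.
  move=> Xx Xy; apply: e_inj.
  - exists (word t x), i; split; first by exists x.
    by apply: eq_from_tnth => k; rewrite word_nth !ord1 addr0.
  - exists (word t y), i; split; first by exists y.
    by apply: eq_from_tnth => k; rewrite word_nth !ord1 addr0.
have lift x : X x -> exists z, [/\ Z z,
    forall j, hom_arc (tex_p T) (z j) = e (word t x j) &
    forall j, hom_arc (tex_q T) (z j) = e (word t (psi x) j)].
  move=> Xx; have : (block_map e @` higher_block t X) (block_map e (word t x)).
    by exists (word t x) => //; exists x.
  rewrite -pZ => -[z Zz pz]; exists z; split=> // j.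
    exact: (congr1 (fun w : config _ => w j) pz).
  have := pq (word t x) z _ Zz pz; rewrite higher_block_map_word => qz.
  by apply: (congr1 (fun w : config _ => w j) (qz _)); exists x.
have [M MP] := injective_block_map_window clZ sZ p_inj.
split=> a b Xa Xb ab pab.
- have [z [Zz pz qz]] := lift a Xa; have [z' [Zz' pz' qz']] := lift b Xb.
  (* The words of length [t] of [a] and [b] agree at positions up to [1 - t], so
     the paths agree up to [1 - t - M]; the words of the images agree up to
     [2 - t], which is the position whose word of [a] ends at coordinate 1. *)
  have zz' n : (n <= M.+1)%N ->
      z (1 - t%:Z - M%:Z + n%:Z) = z' (1 - t%:Z - M%:Z + n%:Z).
    elim: n => [|n IH] nM.
      rewrite addr0; apply: MP => // j hj; rewrite pz pz'; congr e.
      by apply/eq_word => i hi; have := ab i; rewrite mul1r; apply; lia.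
    set i := _ + n%:Z in IH *.
    have -> : 1 - t%:Z - M%:Z + n.+1%:Z = i + 1 by rewrite /i; lia.
    apply: wr; first by rewrite -(Zp z Zz) -(Zp z' Zz') IH//; lia.
    rewrite qz qz'; congr e; apply/eq_word => k hk.
    by have := pab k; rewrite mul1r; apply; rewrite /i in hk; lia.
  have := zz' M.+1 (leqnn _).
  move=> /(congr1 (hom_arc (tex_p T))); rewrite pz pz'.
  by move=> /(e_inj_word _ _ _ Xa Xb)/eq_word; apply; lia.
- have [z [Zz pz qz]] := lift a Xa; have [z' [Zz' pz' qz']] := lift b Xb.
  (* Here the words agree from position 0 on and the words of the images from
     position -1 on, so the paths agree from [M] on, then down to -1. *)
  have zz' n : (n <= M.+1)%N -> z (M%:Z - n%:Z) = z' (M%:Z - n%:Z).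
    elim: n => [|n IH] nM.
      rewrite subr0; apply: MP => // j hj; rewrite pz pz'; congr e.
      by apply/eq_word => i hi; have := ab (- i); rewrite mulN1r opprK; apply; lia.
    set i := _ - n.+1%:Z.
    have E : M%:Z - n%:Z = i + 1 by rewrite /i; lia.
    apply: wl; first by rewrite (Zp z Zz) (Zp z' Zz') -E IH//; lia.
    rewrite qz qz'; congr e; apply/eq_word => k hk.
    by have := pab (- k); rewrite mulN1r opprK; apply; rewrite /i in hk; lia.
  have := zz' M.+1 (leqnn _).
  move=> /(congr1 (hom_arc (tex_p T))); rewrite pz pz'.
  by move=> /(e_inj_word _ _ _ Xa Xb)/eq_word; apply; lia.
Qed.

(** * From determination to a biresolving textile system *)

Definition word_prefix (A : finType) (t : nat) (w : t.+1.-tuple A) : t.-tuple A :=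
  [tuple tnth w (widen_ord (leqnSn t) i) | i < t].

Definition word_suffix (A : finType) (t : nat) (w : t.+1.-tuple A) : t.-tuple A :=
  [tuple tnth w (lift ord0 i) | i < t].

Lemma prefix_word (A : finType) (t : nat) (x : config A) (j : int) :
  word_prefix (word t.+1 x j) = word t x j.
Proof. by apply: eq_from_tnth => i; rewrite tnth_mktuple !word_nth. Qed.

Lemma suffix_word (A : finType) (t : nat) (x : config A) (j : int) :
  word_suffix (word t.+1 x j) = word t x (j + 1).
Proof.
apply: eq_from_tnth => i; rewrite tnth_mktuple !word_nth lift0.
by congr (x _); lia.
Qed.

(** The de Bruijn graph of the alphabet: it carries all words of length [t + 1]
    as arcs, so it can be the target of both homomorphisms. *)
Definition block_graph (A : finType) (t : nat) : digraph :=
  Digraph (@word_prefix A t) (@word_suffix A t).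

Definition word_pair (A : finType) (psi : config A -> config A) (t : nat)
    (x : config A) (j : int) : t.-tuple A * t.-tuple A :=
  (word t x j, word t (psi x) j).

(** Occurrences at position 0 suffice because [X] is shift-invariant. *)
Definition word_pairs (A : finType) (X : set (config A))
    (psi : config A -> config A) (t : nat) : finType :=
  {uv : t.-tuple A * t.-tuple A
    | `[< exists2 x, X x & uv = word_pair psi t x 0 >]}.

Definition word_pair_graph (A : finType) (X : set (config A))
    (psi : config A -> config A) (t : nat) : digraph :=
  @Digraph (t.-tuple A * t.-tuple A)%type (word_pairs X psi t.+1)
    (fun uv => (word_prefix (val uv).1, word_prefix (val uv).2))
    (fun uv => (word_suffix (val uv).1, word_suffix (val uv).2)).

Definition word_pair_textile (A : finType) (X : set (config A))
    (psi : config A -> config A) (t : nat) : textile_system :=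
  Textile
    (@GraphHom (word_pair_graph X psi t) (block_graph A t)
       (fun uv => (val uv).1) fst (fun=> erefl) (fun=> erefl))
    (@GraphHom (word_pair_graph X psi t) (block_graph A t)
       (fun uv => (val uv).2) snd (fun=> erefl) (fun=> erefl)).

(** An arc is a pair of words of length [M + 2] read in [x] and [psi x] at the
    coordinates 0 to [M + 1]. Its terminal vertex and its second word leave
    only the letter of [x] at 0 unknown, and its initial vertex and its second
    word only the letter at [M + 1]; each is determined by [psi] with
    slack 0. *)
Lemma word_pair_textile_biresolving (A : finType) (X : set (config A))
    (psi : config A -> config A) :
  subshift X -> endomorphism X psi ->
  determines X psi 1 0 -> determines X psi (-1) 0 ->
  exists t, textile_weakly_q_biresolving (word_pair_textile X psi t).
Proof.
move=> sX Hpsi /(determines_window sX Hpsi)[M1 D1].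
move=> /(determines_window sX Hpsi)[M2 D2].
pose M := maxn M1 M2; exists M.+1;
split=> [] [u pu] [v pv] /= uv uv2; apply: val_inj => /=.
- have /asboolP[x Xx ux] := pu; have /asboolP[y Xy vy] := pv.
  move: uv uv2; rewrite ux vy /= !suffix_word !add0r.
  move=> /(congr1 fst)/eq_word xy1 /eq_word xy2.
  suff x0 : x 0 = y 0.
    congr pair; apply/eq_word => j hj; last exact: xy2.
    by have [->//|/eqP j0] := eqVneq j 0; apply: xy1; lia.
  rewrite -(addrN (1 : int)).
  apply: (D2 M) => // [|j hj|j hj]; first exact: leq_maxr.
  + by apply: xy1; lia.
  + by apply: xy2; lia.
- have /asboolP[x Xx ux] := pu; have /asboolP[y Xy vy] := pv.
  move: uv uv2; rewrite ux vy /= !prefix_word.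
  move=> /(congr1 fst)/eq_word xy1 /eq_word xy2.
  suff xM : x (M%:Z + 1) = y (M%:Z + 1).
    congr pair; apply/eq_word => j hj; last exact: xy2.
    by have [->//|/eqP j0] := eqVneq j (M%:Z + 1); apply: xy1; lia.
  apply: (D1 M) => // [|j hj|j hj]; first exact: leq_maxl.
  + by apply: xy1; lia.
  + by apply: xy2; lia.
Qed.

Definition word_pair_points (A : finType) (X : set (config A))
    (psi : config A -> config A) (t : nat)
    : set (config (word_pairs X psi t)) :=
  [set z | exists2 x, X x & forall j, val (z j) = word_pair psi t x j].

Lemma word_pair_lift (A : finType) (X : set (config A))
    (psi : config A -> config A) (t : nat) (x : config A) :
  subshift X -> endomorphism X psi -> X x ->
  exists z : config (word_pairs X psi t),
    forall j, val (z j) = word_pair psi t x j.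
Proof.
move=> [_ sX] Hpsi Xx.
have mem j : `[< exists2 y, X y & word_pair psi t x j = word_pair psi t y 0 >].
  apply/asboolP; exists (shiftZ j x); first exact: subshift_shift.
  rewrite /word_pair (endomorphism_shift _ sX Hpsi)//.
  by congr pair; apply: eq_from_tnth => i; rewrite !word_nth /shiftZ;
    congr (_ _); lia.
by exists (fun j => exist _ (word_pair psi t x j) (mem j)).
Qed.

(** A limit point is decoded by reading first letters; continuity of [psi] lets
    the second components pass to the limit. *)
Lemma word_pair_points_closed (A : finType) (X : set (config A))
    (psi : config A -> config A) (t : nat) :
  closed X -> endomorphism X psi -> closed (@word_pair_points A X psi t.+1).
Proof.
move=> clX [_ cpsi _]; apply/closed_agreeP => z zZ.
pose x : config A := fun j => tnth (val (z j)).1 ord0.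
have zx n : exists y, [/\ X y, agree n x y & forall j, - n%:Z <= j <= n%:Z ->
    val (z j) = word_pair psi t.+1 y j].
  have [z' [y Xy z'y] zz'] := zZ n; exists y; split=> // j hj.
    by rewrite /x zz'// z'y word_nth addr0.
  by rewrite zz'.
have Xx : X x.
  move/closed_agreeP: clX; apply => n; have [y [Xy xy _]] := zx n.
  by exists y.
exists x => // j.
pose n := (`|j| + t.+1)%N; have [m mP] := continuous_agree n cpsi Xx.
have [y [Xy xy zy]] := zx (maxn m n).
have pxy : agree n (psi x) (psi y) by apply: mP => //; apply: agreeW xy; lia.
rewrite zy; last by lia.
by congr pair; apply/eq_word => i hi; apply/esym; [apply: xy|apply: pxy]; lia.
Qed.

Lemma word_pair_points_shift (A : finType) (X : set (config A))
    (psi : config A -> config A) (t : nat) :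
  subshift X -> endomorphism X psi ->
  shiftZ 1 @` @word_pair_points A X psi t = @word_pair_points A X psi t.
Proof.
move=> [_ sX] Hpsi.
have sh s z : @word_pair_points A X psi t z -> word_pair_points (shiftZ s z).
  move=> [x Xx zx]; exists (shiftZ s x) => [|j]; first exact: subshift_shift.
  rewrite [LHS]zx /word_pair (endomorphism_shift _ sX Hpsi)//.
  by congr pair; apply: eq_from_tnth => i; rewrite !word_nth /shiftZ;
    congr (_ _); lia.
rewrite eqEsubset; split=> [_ [z Zz <-]|z Zz]; first exact: sh.
by exists (shiftZ (-1) z); [exact: sh|rewrite shiftZD addrN shiftZ0].
Qed.

Lemma determines_biresolving (A : finType) (X : set (config A))
    (psi : config A -> config A) :
  subshift X -> endomorphism X psi ->
  determines X psi 1 0 -> determines X psi (-1) 0 ->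
  exists (t : nat) (ht : (0 < t)%N),
    weakly_q_biresolving (higher_block t X) (higher_block_map ht psi).
Proof.
move=> sX Hpsi D1 D2; have [clX _] := sX; have [Xpsi _ _] := Hpsi.
have [t bires] := word_pair_textile_biresolving sX Hpsi D1 D2.
exists t.+1, isT, (word_pair_textile X psi t), id, (@word_pair_points A X psi t.+1).
move=> phi_p phi_q eX.
have pE z x : (forall j, val (z j) = word_pair psi t.+1 x j) ->
    phi_p z = word t.+1 x.
  by move=> zx; apply/funext => j; rewrite /phi_p /block_map /= zx.
have qE z x : (forall j, val (z j) = word_pair psi t.+1 x j) ->
    phi_q z = word t.+1 (psi x).
  by move=> zx; apply/funext => j; rewrite /phi_q /block_map /= zx.
have winj := @word_inj A t.+1 isT.
split=> //.
- split.
  + exact: word_pair_points_closed.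
  + exact: word_pair_points_shift.
  + move=> z [x _ zx] j /=; rewrite !zx /= !suffix_word !prefix_word //.
- split.
  + move=> z z' /set_mem[x _ zx] /set_mem[y _ zy].
    rewrite (pE _ _ zx) (pE _ _ zy) => /winj xy.
    by apply/funext => j; apply: val_inj; rewrite zx zy xy.
  + rewrite eqEsubset; split=> [_ [z [x Xx zx] <-]|_ [_ [x Xx <-] <-]].
      by rewrite (pE _ _ zx); exists (word t.+1 x) => //; exists x.
    have [z zx] := word_pair_lift t.+1 sX Hpsi Xx.
    by exists z; [exists x|rewrite (pE _ _ zx)].
  + move=> _ [z [x Xx zx] <-]; rewrite (qE _ _ zx).
    by exists (word t.+1 (psi x)) => //; exists (psi x) => //; exact: Xpsi.
- move=> _ z [x Xx <-] [y Xy zy]; rewrite (pE _ _ zy) (qE _ _ zy).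
  by move=> /winj ->; rewrite higher_block_map_word.
Qed.

Lemma biresolvingP (A : finType) (X : set (config A))
    (psi : config A -> config A) :
  subshift X -> endomorphism X psi ->
  (exists (t : nat) (ht : (0 < t)%N),
    weakly_q_biresolving (higher_block t X) (higher_block_map ht psi)) <->
  determines X psi 1 0 /\ determines X psi (-1) 0.
Proof.
move=> sX Hpsi; split=> [[t [ht]]|[]]; first exact: biresolving_determines.
exact: determines_biresolving.
Qed.

(** An integer between [- u] and [v] is found at a finite end of that interval,
    or at 0 when both ends are infinite; [+oo + -oo] is [-oo], in agreement
    with the emptiness of the interval in that case. *)
Lemma adde_ge0_between (u v : \bar int) :
  (0 <= u + v)%E <-> exists s : int, (- u <= s%:E)%E /\ (s%:E <= v)%E.
Proof.
case: u v => [u| |] [v| |] /=; rewrite ?lee_fin; split=> //.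
- by move=> uv; exists v; rewrite !lee_fin; lia.
- by case=> s; rewrite !lee_fin; lia.
- by move=> _; exists (- u); rewrite lee_fin lexx leey.
- by case=> s [].
- by move=> _; exists v; rewrite lexx leNye.
- by move=> _; exists 0; rewrite leNye leey.
- by case=> s [].
- by case=> s [].
- by case=> s [].
- by case=> s [].
Qed.

Lemma lte_int (s : int) (u : \bar int) :
  (s%:E < u)%E = ((s + 1)%:E <= u)%E.
Proof. by case: u => [u| |] //=; rewrite ?lte_fin ?lee_fin ?ltey ?leey// addrC lez1D. Qed.

Theorem theorem5p3 (R : realType) (A : finType) (hA : (1 < #|A|)%N)
    (X : set (config A)) (hX : subshift X)
    (phi : config A -> config A) (hphi : endomorphism X phi)
    (d : config A -> config A -> R) (hd : compatible_metric X d) :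
  [/\ ((0 <= Q_R X phi + Q_L X phi)%E <->
       exists s : int, exists (t : nat) (ht : (0 < t)%N),
         weakly_q_biresolving (higher_block t X)
           (higher_block_map ht (phi \o shiftZ s))),
      (forall s : int,
         (exists (t : nat) (ht : (0 < t)%N),
            weakly_q_biresolving (higher_block t X)
              (higher_block_map ht (phi \o shiftZ s))) <->
         (- Q_R X phi <= s%:E)%E /\ (s%:E <= Q_L X phi)%E) &
      (forall s : int, (- Q_R X phi < s%:E)%E -> (s%:E < Q_L X phi)%E ->
         positively_expansive X d (phi \o shiftZ s))].
Proof.
have phis s : endomorphism X (phi \o shiftZ s) by exact: endomorphism_comp_shift.
have R_le s r : determines X (phi \o shiftZ s) 1 r <->
    ((r - s)%:E <= Q_R X phi)%E.
  rewrite le_Q_R//; have := determines_comp_shift s r (or_introl erefl) hX hphi.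
  by rewrite mul1r.
have L_le s r : determines X (phi \o shiftZ s) (-1) r <->
    ((r + s)%:E <= Q_L X phi)%E.
  rewrite le_Q_L//; have := determines_comp_shift s r (or_intror erefl) hX hphi.
  by rewrite mulN1r opprK.
have bires s : (exists (t : nat) (ht : (0 < t)%N),
      weakly_q_biresolving (higher_block t X)
        (higher_block_map ht (phi \o shiftZ s))) <->
    (- Q_R X phi <= s%:E)%E /\ (s%:E <= Q_L X phi)%E.
  by rewrite biresolvingP// R_le L_le sub0r add0r EFinN leeNl.
split=> // [|s].
  rewrite adde_ge0_between; split=> -[s hs]; exists s; exact/bires.
rewrite lteNl -EFinN !lte_int => hR hL.
apply: determines_expansive => //; first by apply/R_le; rewrite addrC.
by apply/L_le; rewrite addrC.
Qed.
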